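(* Let $t\ge 1$, $\alpha>0$, and $\mathbf{h}=[h_1\cdots h_t]^T\sim\mathrm{CN}(\mathbf{I}_t)$. Consider the interleaved antenna selection Scheme $\mathtt{B}$: starting with $i=1$, the transmitter trains antenna $i$ (so the receiver learns $h_i$); the receiver feeds back the single bit $\mathtt{1}$ if $|h_i|^2\ge\alpha$ and $\mathtt{0}$ otherwise; if the bit is $\mathtt{0}$ and $i<t$, set $i\leftarrow i+1$ and repeat; otherwise the process stops and the transmitter transmits using beamforming vector $\mathbf{e}_i$. Consider also the conventional antenna selection Scheme $\mathtt{A}$, which trains all $t$ antennas, feeds back $\lceil\log_2 t\rceil$ bits, and transmits with $\mathbf{e}_\tau$ where $\tau=\arg\max_i|h_i|$. Then $\mathtt{out}(\mathtt{B})=\mathtt{out}(\mathtt{A})=(1-e^{-\alpha})^t$, and $$\mathtt{tl}(\mathtt{B})=\mathtt{fr}(\mathtt{B})=e^{\alpha}\bigl(1-(1-e^{-\alpha})^t\bigr)<e^{\alpha}.$$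
   Context: $\mathbf{e}_i$ is the $i$-th standard basis vector of $\mathbb{C}^t$. For a scheme that transmits with beamforming vector $\mathbf{x}(\mathbf{h})$ (with $\|\mathbf{x}\|\le1$), the outage probability is $\mathtt{out}=\mathrm{P}(|\langle\mathbf{x}(\mathbf{h}),\mathbf{h}\rangle|^2<\alpha)$, where $\langle\mathbf{x},\mathbf{h}\rangle=\sum_i \overline{x_i}h_i$. The training length $\mathtt{tl}$ of a scheme is the expected number of antennas trained per channel state, and its feedback rate $\mathtt{fr}$ is the expected number of feedback bits sent per channel state. $\mathrm{CN}(\mathbf{I}_t)$: i.i.d. standard circularly-symmetric complex Gaussian entries. *)

(* Defs.v *)
From HB Require Import structures.
From mathcomp Require Import all_boot all_order all_algebra.
From mathcomp Require Import all_classical all_reals all_analysis.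
From mathcomp Require Import complex.
Set Implicit Arguments. Unset Strict Implicit. Unset Printing Implicit Defensive.
Import Order.TTheory GRing.Theory Num.Theory.
Local Open Scope classical_set_scope.
Local Open Scope ring_scope.
Local Open Scope complex_scope.

Section Defs.
Variables (R : realType) (d : measure_display) (T : measurableType d).
Variable (P : probability T R).

(* Mutual independence of a finite family of real random variables:
   the product rule for every choice of Borel sets (taking B i = setT
   for some indices gives the rule for every subfamily). *)
Definition mutually_independent (I : finType) (X : I -> T -> R) : Prop :=
  forall B : I -> set R, (forall i, measurable (B i)) ->
    P (\bigcap_(i in [set: I]) (X i @^-1` B i)) =
    (\prod_(i : I) P (X i @^-1` B i))%E.

Definition reim_part (t : nat) (h : T -> 'I_t -> R[i]) (ib : 'I_t * bool) : T -> R :=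
  fun w => if ib.2 then complex.Re (h w ib.1) else complex.Im (h w ib.1).

Definition is_std_CN (t : nat) (h : T -> 'I_t -> R[i]) : Prop :=
  [/\ forall ib, measurable_fun setT (reim_part h ib),
      mutually_independent (reim_part h) &
      forall ib (B : set R), measurable B ->
        P (reim_part h ib @^-1` B) = normal_prob 0 (Num.sqrt (2^-1)) B].

Definition cinner (t : nat) (x h : 'I_t -> R[i]) : R[i] :=
  \sum_(i < t) (x i)^* * h i.

Definition ebasis (t : nat) (k : 'I_t) : 'I_t -> R[i] :=
  fun i => if i == k then 1 else 0.

Record scheme_out (t : nat) := SchemeOut {
  beam : 'I_t -> R[i];
  ntrain : nat;
  nfeedback : nat }.

Definition outage (t : nat) (alpha : R) (h : T -> 'I_t -> R[i])
    (S : ('I_t -> R[i]) -> scheme_out t) : \bar R :=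
  P [set w | `|cinner (beam (S (h w))) (h w)| ^+ 2 < alpha%:C].

Definition training_length (t : nat) (h : T -> 'I_t -> R[i])
    (S : ('I_t -> R[i]) -> scheme_out t) : \bar R :=
  'E_P[fun w => (ntrain (S (h w)))%:R].

Definition feedback_rate (t : nat) (h : T -> 'I_t -> R[i])
    (S : ('I_t -> R[i]) -> scheme_out t) : \bar R :=
  'E_P[fun w => (nfeedback (S (h w)))%:R].

End Defs.

(* Scheme B (interleaved): antennas 0,1,... are trained in turn (0-based);
   the stopping index is the first i with |h_i|^2 >= alpha, or the last
   antenna t-1 if there is none.  With stopping index k, k+1 antennas are
   trained and k+1 one-bit feedbacks are sent; transmission uses e_k. *)
Definition schemeB_index (R : realType) (t : nat) (alpha : R) (h : 'I_t -> R[i]) : nat :=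
  minn (find (fun i : 'I_t => alpha%:C <= `|h i| ^+ 2) (enum 'I_t)) t.-1.

Definition schemeB (R : realType) (t : nat) (alpha : R) (h : 'I_t -> R[i]) : scheme_out R t :=
  let k := schemeB_index alpha h in
  SchemeOut (fun i => if val i == k then 1 else 0) k.+1 k.+1.

Definition schemeA (R : realType) (t : nat) (h : 'I_t -> R[i]) : scheme_out R t :=
  SchemeOut
    (match [pick tau | [forall j, `|h j| <= `|h tau|]] with
     | Some tau => @ebasis R t tau
     | None => fun _ => 0
     end)
    t (up_log 2 t).

(* Submission.v *)
Require Import Defs.
From HB Require Import structures.
From mathcomp Require Import all_boot all_order all_algebra.
From mathcomp Require Import all_classical all_reals all_analysis.
From mathcomp Require Import complex measurable_realfun.
From mathcomp Require Import ring.
Set Implicit Arguments. Unset Strict Implicit. Unset Printing Implicit Defensive.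
Import Order.TTheory GRing.Theory Num.Theory.
Import numFieldNormedType.Exports.
Local Open Scope classical_set_scope.
Local Open Scope ring_scope.

(* Both schemes are in outage exactly when |h_i|^2 < alpha for every i: Scheme B
   stops on a failing antenna only if all antennas fail, and Scheme A fails iff
   the largest gain does.  These events are independent, and each has
   probability 1 - e^-alpha because |h_i|^2 is exponentially distributed.  As
   antenna j is trained iff all previous ones failed, the expected number of
   trained antennas is the geometric sum of the (1 - e^-alpha)^j for j < t.

   For the exponential law of x^2 + y^2 with (x, y) Gaussian, substituting
   y = |x| u and then v = x sqrt(1 + u^2) writes P(x^2 + y^2 >= a) as the product
   of the integral of |v| e^-v^2 over v^2 >= a, which is e^-a, and a factor
   independent of a; the latter is 1, as the case a = 0 shows. *)

(** * Measures given by a density *)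

Section density_measure.
Context d (T : measurableType d) (R : realType).
Variables (mu : {measure set T -> \bar R}) (f : T -> R).
Hypotheses (mf : measurable_fun setT f) (f0 : forall x, 0 <= f x).
Local Open Scope ereal_scope.

(** Registered as a measure so that the planar Gaussian density can be compared with a product
    measure by uniqueness. *)
Definition density_measure (A : set T) : \bar R := \int[mu]_(x in A) (f x)%:E.

Let density0 : density_measure set0 = 0.
Proof. exact: integral_set0. Qed.

Let density_ge0 A : 0 <= density_measure A.
Proof. by apply: integral_ge0 => x _; rewrite lee_fin. Qed.

Let density_sigma_additive : semi_sigma_additive density_measure.
Proof.
move=> F mF tF mUF; rewrite /density_measure ge0_integral_bigcup//.
- by apply: is_cvg_ereal_nneg_natsum_cond => n _ _; exact: density_ge0.
- exact/measurable_EFinP/measurable_funTS.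
- by move=> x _; rewrite lee_fin.
Qed.

HB.instance Definition _ := isMeasure.Build _ _ _ density_measure
  density0 density_ge0 density_sigma_additive.

End density_measure.

(** * Lebesgue integrals on the line: scaling, symmetry, Gaussian tail *)

Section scaling.
Context {R : realType}.
Local Notation mu := (@lebesgue_measure R).
Local Open Scope ereal_scope.

Section scaled_lebesgue_measure.
Variables (c : R) (c0 : (0 < c)%R).

Let mM : measurable_fun setT
  ( *%R c : measurableTypeR R -> measurableTypeR R).
Proof. exact: measurable_funM. Qed.

Let pushM : {measure set (measurableTypeR R) -> \bar R} :=
  measure_function_pushforward__canonical__measure_function_Measure mu mM.

Let scaled_mu : {measure set (measurableTypeR R) -> \bar R} :=
  mscale (NngNum (ltW c0)) pushM.

(** Both measures agree on half-open intervals: the preimage of []a, b]] is []a / c, b / c]], and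
    the factor [c] restores its length. *)
Let scaled_muE (A : set R) : measurable A -> mu A = scaled_mu A.
Proof.
apply: lebesgue_measure_unique => //= _ [[a b]] _ <-.
rewrite /scaled_mu /= /mscale /= /pushM /= /pushforward.
rewrite (_ : *%R c @^-1` _ = `]a / c, b / c]%classic)%R; last first.
  apply/seteqP; split => x /=; rewrite !in_itv/= ltr_pdivrMr// ler_pdivlMr//;
    by rewrite (mulrC c).
rewrite !lebesgue_measure_itv/= !lte_fin ltr_pM2r ?invr_gt0//.
case: ifP => _; last by rewrite mule0.
by rewrite -!EFinB -EFinM -mulrBl mulrCA divff ?mulr1// gt_eqF.
Qed.

(** Obtained from an equality of measures rather than from derivatives, so that it covers integrands
    with indicator factors. *)
Lemma ge0_integral_scale (f : R -> \bar R) :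
  measurable_fun setT f -> (forall x, 0 <= f x) ->
  \int[mu]_x f x = c%:E * \int[mu]_x f (c * x)%R.
Proof.
move=> mf f0.
transitivity (\int[scaled_mu]_x f x).
  by apply: eq_measure_integral => // A mA _; exact: scaled_muE.
by rewrite ge0_integral_mscale// ge0_integral_pushforward.
Qed.

End scaled_lebesgue_measure.

(** The reflection [x -> - x] maps the negative half-line onto the positive one, up to the null
    point 0. *)
Lemma ge0_integral_even (f : R -> R) : measurable_fun setT f ->
  (forall x, 0 <= f x)%R -> (forall x, f (- x) = f x)%R ->
  \int[mu]_x (f x)%:E = 2%:E * \int[mu]_(x in `[0%R, +oo[) (f x)%:E.
Proof.
move=> mf f0 fN.
have mfE D : measurable_fun D (fun x => (f x)%:E).
  exact/measurable_EFinP/measurable_funTS.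
rewrite -(setUv `[0%R, +oo[%classic) ge0_integral_setU//=; last 4 first.
- exact: measurableC.
- exact: mfE.
- by move=> x _; rewrite lee_fin.
- exact/disj_setPCl.
rewrite mule_natl mule2n; congr +%E.
rewrite setCitvr integral_itv_bndo_bndc; last exact: mfE.
rewrite [RHS]ge0_integration_by_substitution0//.
by apply: eq_integral => x _; rewrite fN.
Qed.

(** By symmetry this is twice the integral of [x * exp(- x^2)] from [Num.sqrt a] on, whose
    antiderivative [- exp(- x^2) / 2] vanishes at infinity. *)
Lemma integral_gauss_tail (a : R) : (0 <= a)%R ->
  \int[mu]_v (`|v| * expR (- v ^+ 2) * (a <= v ^+ 2)%R%:R)%:E = (expR (- a))%:E.
Proof.
move=> a0.
have mg : measurable_fun setT (fun v : R => `|v| * expR (- v ^+ 2))%R.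
  apply: measurable_funM; first exact: normr_measurable.
  exact: measurable_gauss_fun.
rewrite (ge0_integral_even (f := fun v => (`|v| * expR (- v ^+ 2) *
  (a <= v ^+ 2)%R%:R)%R)); first last.
- by move=> v; rewrite normrN sqrrN.
- by move=> v; rewrite !mulr_ge0 ?expR_ge0.
- apply: measurable_funM => //.
  rewrite (_ : (fun _ => _) = \1_[set v : R | a <= v ^+ 2]%R); last first.
    by apply/funext => v; rewrite indicE mem_setE.
  apply: measurable_indic; rewrite -[X in measurable X]setTI.
  by apply: measurable_fun_ler => //; exact: measurable_funX.
have -> : \int[mu]_(x in `[0%R, +oo[) (`|x| * expR (- x ^+ 2) *
    (a <= x ^+ 2)%R%:R)%:E =
    \int[mu]_(x in `[Num.sqrt a, +oo[) (x * expR (- x ^+ 2))%:E.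
  rewrite [LHS]integral_mkcond [RHS]integral_mkcond; apply: eq_integral => x _.
  rewrite !patchE !mem_setE !in_itv/= !andbT.
  have [x0|x0] := leP 0%R x; last first.
    by rewrite leNgt (lt_le_trans x0 (sqrtr_ge0 a)).
  have -> : (Num.sqrt a <= x)%R = (a <= x ^+ 2)%R.
    by rewrite -(@ler_pXn2r _ 2)// ?nnegrE// sqr_sqrtr.
  by rewrite ger0_norm//; case: ifP; rewrite ?mulr1// mulr0.
pose F (x : R) := (- (2^-1 * gauss_fun x))%R.
have dF (x : R) : is_derive x 1%R F (x * expR (- x ^+ 2))%R.
  rewrite /F /gauss_fun; apply: is_derive_eq.
  by rewrite /GRing.scale/=; field; rewrite ?pnatr_eq0.
have cF : continuous F.
  move=> x; apply: cvgN; apply: cvgMl_tmp; exact: continuous_gauss_fun.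
rewrite (@ge0_continuous_FTC2y _ _ F _ 0%R).
- rewrite /F /gauss_fun sqr_sqrtr// sub0e -EFinN -EFinM opprK.
  by rewrite mulrA divff// mul1r.
- by move=> x ax; rewrite mulr_ge0 ?expR_ge0// (le_trans _ ax).
- apply: continuous_subspaceT => x; apply: cvgM; first exact: cvg_id.
  exact: continuous_gauss_fun.
- rewrite -oppr0; apply: cvgN; rewrite -(mulr0 2^-1%R).
  by apply: cvgMl_tmp; exact: cvg_gauss_fun.
- by move=> x _; have := dF x; case.
- exact/cvg_at_right_filter/cF.
- by move=> x _; rewrite derive1E; exact: derive_val.
Qed.

End scaling.

(** * The law of two independent normals of variance 1/2 *)

Section gaussian_plane.
Context {R : realType}.
Local Notation mu := (@lebesgue_measure R).
Local Notation N := (normal_prob 0 (Num.sqrt (2^-1 : R))).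
Local Open Scope ereal_scope.

(** This is 1 / sqrt(pi), as the variance is 1/2. *)
Let c : R := normal_peak (Num.sqrt (2^-1)).

Let pdfE (x : R) : normal_pdf 0 (Num.sqrt 2^-1) x = (c * expR (- x ^+ 2))%R.
Proof.
rewrite normal_pdfE ?gt_eqF ?sqrtr_gt0// /normal_fun subr0 sqr_sqrtr//.
by rewrite -(mulr_natr 2^-1 2) mulVf// divr1.
Qed.

Definition gauss2 (z : R * R) : R :=
  (c ^+ 2 * expR (- (z.1 ^+ 2 + z.2 ^+ 2)))%R.

Let gauss2_ge0 z : (0 <= gauss2 z)%R.
Proof. by rewrite mulr_ge0 ?expR_ge0// sqr_ge0. Qed.

Let measurable_normsq :
  measurable_fun setT (fun z : R * R => z.1 ^+ 2 + z.2 ^+ 2)%R.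
Proof. by apply: measurable_funD; exact: measurable_funX. Qed.

Lemma measurable_gauss2 : measurable_fun setT gauss2.
Proof.
apply: measurable_funM => //; apply: measurableT_comp => //.
exact: measurableT_comp.
Qed.

(** A product measure is determined by its values on rectangles, and there Tonelli splits the
    integral of the density into the two marginals. *)
Lemma normal_prob2_density (D : set (R * R)) : measurable D ->
  (N \x N) D = density_measure (mu \x mu) gauss2 D.
Proof.
move=> mD.
pose m := Submission_density_measure__canonical__measure_function_Measure
  (mu \x mu) measurable_gauss2 gauss2_ge0.
have mp (A : set R) : measurable A -> measurable_fun setT
    (fun x : R => (c * expR (- x ^+ 2) * \1_A x)%:E).
  move=> mA; apply/measurable_EFinP; apply: measurable_funM => //.
  by apply: measurable_funM => //; exact: measurable_gauss_fun.
have p0 (A : set R) (x : R) : 0 <= (c * expR (- x ^+ 2) * \1_A x)%:E.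
  by rewrite lee_fin !mulr_ge0 ?expR_ge0// normal_peak_ge0.
have NE (A : set R) : measurable A ->
    N A = \int[mu]_x (c * expR (- x ^+ 2) * \1_A x)%:E.
  move=> mA; rewrite /normal_prob integral_mkcond; apply: eq_integral => x _.
  by rewrite patchE indicE pdfE; case: ifP; rewrite ?mulr1 ?mulr0.
apply: (product_measure_unique (m' := m)) => // A B mA mB.
transitivity (\int[mu \x mu]_z ((c * expR (- z.1 ^+ 2) * \1_A z.1)%:E *
    (c * expR (- z.2 ^+ 2) * \1_B z.2)%:E)).
  rewrite /m /= /density_measure integral_mkcond; apply: eq_integral => -[x y] _.
  rewrite patchE in_setX !indicE /gauss2/= -EFinM opprD expRD.
  case: (x \in A); case: (y \in B) => /=;
    rewrite ?mulr0 ?mul0r ?mulr1//; congr EFin; ring.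
rewrite fubini_tonelli1/=; last 2 first.
- apply: emeasurable_funM.
    exact: (measurableT_comp (mp A mA)).
  exact: (measurableT_comp (mp B mB)).
- by move=> z; rewrite mule_ge0.
rewrite /fubini_F /=.
transitivity (\int[mu]_x ((c * expR (- x ^+ 2) * \1_A x)%:E * N B)).
  by apply: eq_integral => x _; rewrite ge0_integralZl ?NE//; exact: mp.
rewrite ge0_integralZr ?NE//; first exact: mp.
by apply: integral_ge0.
Qed.

Let measurable_leb d (T : measurableType d) (a : R) (f : T -> R) :
  measurable_fun setT f -> measurable_fun setT (fun x => (a <= f x)%R%:R : R).
Proof.
move=> mf; rewrite (_ : (fun _ => _) = \1_[set x | a <= f x]%R); last first.
  by apply/funext => v; rewrite indicE mem_setE.
apply: measurable_indic; rewrite -[X in measurable X]setTI.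
exact: measurable_fun_ler.
Qed.

Lemma normal_prob2_annulus (a : R) : (0 <= a)%R ->
  (N \x N) [set z : R * R | a <= z.1 ^+ 2 + z.2 ^+ 2]%R = (expR (- a))%:E.
Proof.
(* The constant factor left by the two substitutions; [main] at [b = 0], where the set is the whole
   plane, forces it to be 1. *)
pose W := \int[mu]_u (c ^+ 2 / (1 + u ^+ 2))%:E.
have q0 (u : R) : (0 < 1 + u ^+ 2)%R by rewrite ltr_wpDr ?sqr_ge0.
have q0' (u : R) : (0 <= 1 + u ^+ 2)%R by exact: ltW.
suff main b : (0 <= b)%R ->
    (N \x N) [set z : R * R | b <= z.1 ^+ 2 + z.2 ^+ 2]%R = W * (expR (- b))%:E.
  move=> a0; rewrite main//.
  have := main 0%R (lexx _); rewrite oppr0 expR0 mule1.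
  rewrite [X in (N \x N) X](_ : _ = setT); last first.
    by apply/seteqP; split => // z _ /=; rewrite addr_ge0 ?sqr_ge0.
  by rewrite probability_setT => <-; rewrite mul1e.
move=> b0.
have mD : measurable [set z : R * R | b <= z.1 ^+ 2 + z.2 ^+ 2]%R.
  rewrite -[X in measurable X]setTI; exact: measurable_fun_ler.
rewrite normal_prob2_density// /density_measure integral_mkcond.
pose f (z : R * R) :=
  (gauss2 z * (b <= z.1 ^+ 2 + z.2 ^+ 2)%R%:R)%R.
have mf : measurable_fun setT f.
  by apply: measurable_funM; [exact: measurable_gauss2|exact: measurable_leb].
have f0 z : (0 <= f z)%R by rewrite mulr_ge0.
transitivity (\int[mu \x mu]_z (f z)%:E).
  apply: eq_integral => z _; rewrite patchE /f; case: ifP => [|/negP].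
    by rewrite inE /= => ->; rewrite mulr1.
  by rewrite inE /= => /negP/negbTE ->; rewrite mulr0.
(* The integrand after [y = |x| * u], the factor [|z.1|] being the Jacobian and [z.2] standing for
   [u]. *)
pose g (z : R * R) := (c ^+ 2 * `|z.1| * expR (- (z.1 ^+ 2 * (1 + z.2 ^+ 2)))
  * (b <= z.1 ^+ 2 * (1 + z.2 ^+ 2))%R%:R)%R.
have mg : measurable_fun setT g.
  have mq : measurable_fun setT (fun z : R * R => z.1 ^+ 2 * (1 + z.2 ^+ 2))%R.
    apply: measurable_funM; first exact: measurable_funX.
    by apply: measurable_funD => //; exact: measurable_funX.
  apply: measurable_funM; last exact: measurable_leb.
  apply: measurable_funM; last first.
    by apply: measurableT_comp => //; exact: measurableT_comp.
  by apply: measurable_funM => //; exact: measurableT_comp.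
have g0 (z : R * R) : (0 <= g z)%R.
  by rewrite /g !mulr_ge0 ?expR_ge0 ?normal_peak_ge0.
have mfE : measurable_fun setT (fun z => (f z)%:E) by exact/measurable_EFinP.
have mgE : measurable_fun setT (fun z => (g z)%:E) by exact/measurable_EFinP.
rewrite fubini_tonelli1//=.
transitivity (\int[mu]_x fubini_F mu (fun z => (g z)%:E) x).
  apply: ge0_ae_eq_integral => //.
  - exact: measurable_fun_fubini_tonelli_F.
  - exact: measurable_fun_fubini_tonelli_F.
  - by move=> x _; apply: integral_ge0 => y _; rewrite lee_fin.
  - by move=> x _; apply: integral_ge0 => y _; rewrite lee_fin.
  (* The substitution degenerates only at [x = 0], a null set. *)
  - exists [set 0%R]; split => //; first exact: lebesgue_measure_set1.
    move=> x /= xN; apply: contrapT => /eqP x0; apply: xN => _.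
    have nx : (0 < `|x|)%R by rewrite normr_gt0.
    rewrite /fubini_F (ge0_integral_scale nx); last 2 first.
      exact: (measurable_fun_pair2 x mfE).
      by move=> y; rewrite lee_fin.
    have mfx : measurable_fun setT (fun y => (f (x, `|x| * y)%R)%:E).
      apply/measurable_EFinP; apply: (measurableT_comp mf).
      by apply: measurable_fun_pair => //; exact: measurable_funM.
    rewrite -ge0_integralZl//; last by move=> y _; rewrite lee_fin.
    apply: eq_integral => y _; rewrite -EFinM; congr EFin.
    rewrite /f /g /gauss2 /= exprMn real_normK ?num_real//.
    rewrite (_ : x ^+ 2 + x ^+ 2 * y ^+ 2 = x ^+ 2 * (1 + y ^+ 2))%R; last ring.
    ring.
(* Tonelli in the other order leaves, for each [u], an integral over [x]. *)
rewrite fubini_tonelli//= /W -ge0_integralZr//; first last.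
- by move=> u _; rewrite lee_fin divr_ge0 ?sqr_ge0.
- apply/measurable_EFinP; apply: measurable_funM => //.
  by apply: continuous_measurable_fun; exact: continuous_oneDsqrV.
apply: eq_integral => u _.
have s0 : (0 < Num.sqrt (1 + u ^+ 2))%R by rewrite sqrtr_gt0.
set s := Num.sqrt (1 + u ^+ 2) in s0.
have s2 : (s ^+ 2 = 1 + u ^+ 2)%R by rewrite sqr_sqrtr.
pose tail (v : R) : R := (`|v| * expR (- v ^+ 2) * (b <= v ^+ 2)%R%:R)%R.
have tail0 v : (0 <= tail v)%R by rewrite !mulr_ge0 ?expR_ge0.
have mtail : measurable_fun setT tail.
  apply: measurable_funM; last by apply: measurable_leb; exact: measurable_funX.
  by apply: measurable_funM; [exact: normr_measurable|exact: measurable_gauss_fun].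
have mtails : measurable_fun setT (fun x => (tail (s * x)%R)%:E).
  apply/measurable_EFinP; apply: (measurableT_comp mtail).
  exact: measurable_funM.
(* Substitute [v = s * x]: the Jacobian and [|v|] together give [s^2 = 1 + u^2], which cancels the
   denominator in [W]. *)
rewrite -(integral_gauss_tail b0) (ge0_integral_scale s0); last 2 first.
- exact/measurable_EFinP.
- by move=> v; rewrite lee_fin.
rewrite muleA -EFinM -ge0_integralZl//; last first.
  by rewrite lee_fin mulr_ge0 ?(ltW s0)// divr_ge0 ?sqr_ge0.
apply: eq_integral => x _; rewrite -EFinM; congr EFin.
rewrite /g /= exprMn normrM (gtr0_norm s0) s2 (mulrC (1 + u ^+ 2))%R.
rewrite !mulrA; congr (_ * _)%R; congr (_ * _)%R.
by rewrite -s2; field; rewrite gt_eqF.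
Qed.

End gaussian_plane.

(** Rectangles are stable under intersection and generate the product sigma-algebra; the whole space
    is a rectangle of finite measure, so the uniqueness theorem applies. *)
Lemma measure_eq_rectangles d1 d2 (T1 : measurableType d1)
    (T2 : measurableType d2) (R : realType)
    (m1 m2 : {measure set (T1 * T2) -> \bar R}) :
  (m1 setT < +oo)%E ->
  (forall A B, measurable A -> measurable B -> m1 (A `*` B) = m2 (A `*` B)) ->
  forall D, measurable D -> m1 D = m2 D.
Proof.
move=> m1T m12 D mD.
apply: (measure_unique [set A `*` B | A in measurable & B in measurable]
  (fun=> setT)) => //.
- by rewrite measurable_prod_measurableType.
- move=> _ _ [A1 mA1 [B1 mB1 <-]] [A2 mA2 [B2 mB2 <-]].
  exists (A1 `&` A2); first exact: measurableI.
  by exists (B1 `&` B2); [exact: measurableI|rewrite setXI].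
- by move=> _; exists setT => //; exists setT => //; rewrite setXTT.
- by apply/seteqP; split => // x _; exists 0%N.
- by move=> _ [A mA [B mB <-]]; exact: m12.
Qed.

(** * Grouping independent variables into independent pairs *)

Section pairwise_grouping.
Context (R : realType) d (T : measurableType d) (P : probability T R).
Context (I : finType) (X : I * bool -> T -> R).
Hypotheses (mX : forall ib, measurable_fun setT (X ib))
  (indepX : mutually_independent P X).
Local Open Scope ereal_scope.

Let Z (i : I) (w : T) : R * R := (X (i, true) w, X (i, false) w).

Lemma measurable_pair_rv i : measurable_fun setT (Z i).
Proof. by apply: measurable_fun_pair; exact: mX. Qed.

Let mZ i D : measurable D -> measurable (Z i @^-1` D).
Proof. by move=> mD; rewrite -[X in measurable X]setTI; exact: measurable_pair_rv. Qed.

(** A rectangle constrains the two coordinates separately, so independence over [I * bool] applies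
    directly. *)
Let indep_rectangles (A B : I -> set R) :
  (forall i, measurable (A i)) -> (forall i, measurable (B i)) ->
  P (\bigcap_(i in [set: I]) (Z i @^-1` (A i `*` B i))) =
  \prod_(i : I) (P (X (i, true) @^-1` A i) * P (X (i, false) @^-1` B i)).
Proof.
move=> mA mB.
pose C ib := if ib.2 then A ib.1 else B ib.1.
have -> : \bigcap_(i in [set: I]) (Z i @^-1` (A i `*` B i)) =
    \bigcap_(ib in [set: I * bool]) (X ib @^-1` C ib).
  apply/seteqP; split => [w Zw [i b] _|w Xw i _].
    by have [? ?] := Zw i Logic.I; case: b.
  by split; [exact: (Xw (i, true))|exact: (Xw (i, false))].
rewrite indepX; last by move=> [i []]; [exact: mA|exact: mB].
rewrite (eq_bigr (fun ib => P (X (ib.1, ib.2) @^-1` C (ib.1, ib.2)))); last first.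
  by case.
rewrite -(pair_bigA _ (fun i b => P (X (i, b) @^-1` C (i, b))))/=.
by apply: eq_bigr => i _; rewrite big_bool.
Qed.

(** Taking the whole line at every other index leaves only the factor of [i]. *)
Lemma pair_rectangle i (A B : set R) : measurable A -> measurable B ->
  P (Z i @^-1` (A `*` B)) =
  P (X (i, true) @^-1` A) * P (X (i, false) @^-1` B).
Proof.
move=> mA mB.
have := @indep_rectangles (fun j => if j == i then A else setT)
  (fun j => if j == i then B else setT).
rewrite (bigD1 i)//= eqxx big1 ?mule1; last first.
  move=> j /negbTE ji; rewrite ji !preimage_setT.
  by rewrite !probability_setT mule1.
move=> <-; last 2 first.
- by move=> j; case: ifP.
- by move=> j; case: ifP.
congr (P _); apply/seteqP; split => w /=.
  by move=> Zw j _; case: eqP => [->|_].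
by move=> /(_ i Logic.I); rewrite eqxx.
Qed.

Lemma mutually_independent_pairs (D : I -> set (R * R)) :
  (forall i, measurable (D i)) ->
  P (\bigcap_(i in [set: I]) (Z i @^-1` D i)) = \prod_(i : I) P (Z i @^-1` D i).
Proof.
move=> mD.
(* The indices still in the list may carry arbitrary sets, all others carry rectangles. With the
   full list this is vacuous. *)
have : forall i, i \notin enum I ->
    exists A B, [/\ measurable A, measurable B & D i = A `*` B].
  by move=> i; rewrite mem_enum.
(* The rectangles are replaced by arbitrary measurable sets one index at a time:
   as functions of [D i], both sides are finite measures. *)
elim: (enum I) D mD => [|i s IH] D mD Drect.
  have /choice[A /choice[B DE]] : forall i, exists A B,
      [/\ measurable A, measurable B & D i = A `*` B].
    by move=> i; exact: Drect.
  have -> : D = fun i => A i `*` B i by apply/funext => i; case: (DE i).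
  rewrite indep_rectangles; last 2 first.
  - by move=> i; case: (DE i).
  - by move=> i; case: (DE i).
  by apply: eq_bigr => i _; case: (DE i) => mA mB _; rewrite pair_rectangle.
(* Only the set at [i] varies; [rest] below collects the constraints at the other indices. *)
pose D' (E : set (R * R)) j := if j == i then E else D j.
have mD' E j : measurable E -> measurable (D' E j).
  by move=> mE; rewrite /D'; case: ifP.
pose rest := \bigcap_(j in [set j | j != i]) (Z j @^-1` D j).
have mrest : measurable rest.
  by apply: fin_bigcap_measurable => [|j _]; [exact: finite_finset|exact: mZ].
have D'E E : \bigcap_(j in [set: I]) (Z j @^-1` D' E j) = Z i @^-1` E `&` rest.
  apply/seteqP; split => [w Dw|w [Ew rw] j _].
    split; first by have := Dw i Logic.I; rewrite /D' /= eqxx.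
    by move=> j /= ji; have := Dw j Logic.I; rewrite /D' /= (negbTE ji).
  by rewrite /D' /=; case: eqP => [->//|/eqP ji]; exact: rw.
pose c := \prod_(j | j != i) P (Z j @^-1` D j).
have prodD' E : \prod_j P (Z j @^-1` D' E j) = P (Z i @^-1` E) * c.
  rewrite (bigD1 i)//= /D' eqxx; congr (_ * _).
  by apply: eq_bigr => j /negbTE ->.
have D'D : D = D' (D i).
  by apply/funext => j; rewrite /D'; case: eqP => // ->.
(* [mscale] takes a nonnegative real, so [c] has to be finite. *)
have cE : (fine c)%:E = c.
  by rewrite fineK// prode_fin_num// => j _; rewrite fin_num_measure//; exact: mZ.
have c0 : (0 <= fine c)%R by rewrite fine_ge0// prode_ge0.
rewrite D'D prodD' D'E.
have mZi := @measurable_pair_rv i.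
(* Both sides as measures of the set at [i]: the law of [Z i] restricted to the event [rest], and
   the law of [Z i] scaled by [c]. *)
pose m1 : {measure set (R * R) -> \bar R} :=
  measure_function_pushforward__canonical__measure_function_Measure
    (measure_function_mrestr__canonical__measure_function_Measure P mrest) mZi.
pose m2 : {measure set (R * R) -> \bar R} := mscale (NngNum c0)
  (measure_function_pushforward__canonical__measure_function_Measure P mZi).
rewrite -[LHS]/(m1 (D i)) -cE muleC -[RHS]/(m2 (D i)).
apply: measure_eq_rectangles => //.
  rewrite (@le_lt_trans _ _ 1) ?ltry//; apply: probability_le1.
  by apply: measurableI => //; exact: mZ.
move=> A B mA mB.
rewrite -[LHS]/(P (Z i @^-1` (A `*` B) `&` rest)).
rewrite -[RHS]/((fine c)%:E * P (Z i @^-1` (A `*` B))) cE muleC -prodD' -D'E.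
(* With a rectangle at [i], only the indices of [s] remain arbitrary. *)
apply: IH => [j|j js]; first by apply: mD'; exact: measurableX.
rewrite /D'; case: eqP => [_|/eqP ji]; first by exists A, B.
by apply: Drect; rewrite inE negb_or ji.
Qed.

End pairwise_grouping.

(** * Pathwise analysis of the two schemes *)

Section schemes.
Context (R : realType) (t : nat).
Implicit Types (alpha : R) (h : 'I_t -> R[i]).
Local Open Scope complex_scope.

(** Real-valued squared modulus: it moves comparisons in the partial order of [R[i]] to the total
    order of [R]. *)
Definition normcsq (z : R[i]) : R := complex.Re z ^+ 2 + complex.Im z ^+ 2.

Lemma sqr_norm_complex (z : R[i]) : `|z| ^+ 2 = (normcsq z)%:C.
Proof.
by case: z => x y; rewrite /normcsq normc_def/= -rmorphXn/= sqr_sqrtr// addr_ge0// sqr_ge0.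
Qed.

Lemma cinner_ebasis (k : 'I_t) h : cinner (@ebasis R t k) h = h k.
Proof.
rewrite /cinner (bigD1 k)//= /ebasis eqxx big1 ?addr0 => [|i /negbTE ->].
  by rewrite rmorph1 mul1r.
by rewrite rmorph0 mul0r.
Qed.

(** As [j <= t - 1], the cap at the last antenna does not interfere, and [find] is at least [j]
    exactly when the test fails on the first [j] antennas. *)
Lemma leq_schemeB_index alpha h (j : nat) : (j < t)%N ->
  (j <= schemeB_index alpha h)%N =
  [forall i : 'I_t, (i < j)%N ==> (normcsq (h i) < alpha)].
Proof.
move=> jt; rewrite /schemeB_index leq_min andbC -ltnS prednK ?jt/=; last first.
  exact: leq_ltn_trans jt.
apply/idP/forallP => [jf i|all_lt].
  apply/implyP => ij; have := before_find i (leq_trans ij jf).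
  by rewrite nth_ord_enum sqr_norm_complex lecR ltNge => ->.
(* Otherwise the search stops at a position before [j], and the antenna found there passes the
   test. *)
rewrite leqNgt; apply/negP => fj.
have := fj; set s := enum _; set a := (fun i => _) => {}fj.
have ft : (find a s < t)%N := ltn_trans fj jt.
have := all_lt (Ordinal ft); rewrite /= fj /= ltNge => /negP; apply.
rewrite -lecR -sqr_norm_complex.
have : has a s by rewrite has_find size_enum_ord.
have E : nth (Ordinal ft) s (find a s) = Ordinal ft.
  exact: (nth_ord_enum _ (Ordinal ft)).
by move=> /(nth_find (Ordinal ft)); rewrite E.
Qed.

(** If the selected antenna fails, the earlier ones failed as well, and it is the last one, because
    a failure elsewhere would have continued the search. *)
Lemma schemeB_success alpha h : (0 < t)%N ->
  (`|cinner (beam (schemeB alpha h)) h| ^+ 2 < alpha%:C) =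
  [forall i : 'I_t, normcsq (h i) < alpha].
Proof.
move=> t0.
have kt : (schemeB_index alpha h < t)%N.
  by rewrite (leq_ltn_trans (geq_minr _ _))// prednK.
pose K := Ordinal kt.
have -> : beam (schemeB alpha h) = @ebasis R t K.
  by apply/funext => i; rewrite /schemeB/= /ebasis -val_eqE.
rewrite cinner_ebasis sqr_norm_complex ltcR.
apply/idP/forallP => [hK i|/(_ K)//].
have Kall := leq_schemeB_index alpha h kt; rewrite leqnn in Kall.
have [iK|Ki|/val_inj -> //] := ltngtP i K.
  by have /forallP/(_ i) := esym Kall; rewrite iK.
(* A later antenna exists, so [K.+1] is a legal index; it was not reached, although all antennas up
   to [K] fail. *)
have K1 : (K.+1 < t)%N by rewrite (leq_ltn_trans Ki).
have := leq_schemeB_index alpha h K1; rewrite ltnn => /esym/negP[].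
apply/forallP => j; apply/implyP; rewrite ltnS leq_eqVlt => /predU1P[/val_inj -> //|jK].
by have /forallP/(_ j) := esym Kall; rewrite jK.
Qed.

(** The selected gain dominates all others, so it is below [alpha] iff every gain is. *)
Lemma schemeA_success alpha h : (0 < t)%N ->
  (`|cinner (beam (schemeA h)) h| ^+ 2 < alpha%:C) =
  [forall i : 'I_t, normcsq (h i) < alpha].
Proof.
move=> t0.
have le_norm (z z' : R[i]) : (`|z| <= `|z'|) = (normcsq z <= normcsq z').
  by rewrite -lecR -!sqr_norm_complex ler_pXn2r ?nnegrE.
rewrite /schemeA/=; case: pickP => [tau /forallP tau_max|no_max].
  rewrite cinner_ebasis sqr_norm_complex ltcR.
  apply/idP/forallP => [htau i|/(_ tau)//].
  by rewrite (le_lt_trans _ htau)// -le_norm.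
(* The default beam never occurs: a nonempty finite family has a maximum. *)
case: (@Order.TotalTheory.arg_maxP _ _ _ (Ordinal t0) predT
  (fun i => normcsq (h i))) => // i _ imax.
have /negP[] := negbT (no_max i).
by apply/forallP => j; rewrite le_norm; exact: imax.
Qed.

(** The count [k.+1] is the number of [j < t] with [j <= k], which turns it into a sum of
    indicators. *)
Lemma schemeB_ntrain_sum alpha h : (0 < t)%N ->
  (ntrain (schemeB alpha h))%:R =
  \sum_(j < t) ([forall i : 'I_t, (i < j)%N ==> (normcsq (h i) < alpha)])%:R :> R.
Proof.
move=> t0; rewrite /schemeB/=.
have kt : (schemeB_index alpha h < t)%N.
  by rewrite (leq_ltn_trans (geq_minr _ _))// prednK.
under eq_bigr => j _ do rewrite -leq_schemeB_index//.
rewrite -natr_sum; congr (_%:R).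
rewrite -big_mkcond /= (eq_bigl (fun j : 'I_t => j < (schemeB_index alpha h).+1)%N) //.
by rewrite -(big_ord_widen _ (fun=> 1%N))// sum1_card card_ord.
Qed.

End schemes.

(** * Outage probability and expected training length *)

Section outage_events.
Context (R : realType) d (T : measurableType d) (P : probability T R).
Context (t : nat) (alpha : R) (h : T -> 'I_t -> R[i]).
Hypotheses (alpha0 : 0 < alpha) (hCN : is_std_CN P h).
Local Open Scope ereal_scope.

Let p : R := (1 - expR (- alpha))%R.

Let disc : set (R * R) := [set z | z.1 ^+ 2 + z.2 ^+ 2 < alpha]%R.

Let measurable_disc : measurable disc.
Proof.
rewrite -[X in measurable X]setTI; apply: measurable_fun_ltr => //.
by apply: measurable_funD; exact: measurable_funX.
Qed.

Let mX ib : measurable_fun setT (reim_part h ib).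
Proof. by case: hCN. Qed.

Let Z i w : R * R := (reim_part h (i, true) w, reim_part h (i, false) w).

Let mZ i : measurable_fun setT (Z i).
Proof. exact: measurable_pair_rv. Qed.

(** The joint law of the two parts is a product of normals, since they are independent; the disc is
    the complement of the set in [normal_prob2_annulus]. *)
Let prob_disc i : P (Z i @^-1` disc) = p%:E.
Proof.
have [_ indep dist] := hCN.
have mZi : measurable_fun setT
    (Z i : T -> measurableTypeR R * measurableTypeR R) by exact: mZ.
pose m : {measure set (measurableTypeR R * measurableTypeR R) -> \bar R} :=
  measure_function_pushforward__canonical__measure_function_Measure P mZi.
transitivity ((normal_prob 0 (Num.sqrt (2^-1 : R)) \x
    normal_prob 0 (Num.sqrt (2^-1 : R))) disc).
  apply/esym; apply: (product_measure_unique (m' := m)) => // A B mA mB.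
  rewrite -[LHS]/(P (Z i @^-1` (A `*` B))).
  by rewrite (pair_rectangle indep)// !dist.
have -> : disc = ~` [set z : R * R | alpha <= z.1 ^+ 2 + z.2 ^+ 2]%R.
  by apply/seteqP; split => z; rewrite /disc /= ltNge => /negP.
rewrite probability_setC.
  by rewrite [X in 1 - X](normal_prob2_annulus (ltW alpha0)) EFinB.
rewrite -[X in measurable X]setTI; apply: measurable_fun_ler => //.
by apply: measurable_funD; exact: measurable_funX.
Qed.

(** The case [k = t] gives the outage event, and [k < t] the indicators in the training length.
    Indices from [k] on carry the whole plane and contribute a factor 1. *)
Lemma prob_first_failures k : (k <= t)%N ->
  measurable [set w | [forall i : 'I_t, (i < k)%N ==> (normcsq (h w i) < alpha)%R]] /\
  P [set w | [forall i : 'I_t, (i < k)%N ==> (normcsq (h w i) < alpha)%R]] =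
    (p ^+ k)%:E.
Proof.
have [_ indep _] := hCN.
move=> kt; pose D (i : 'I_t) := if (i < k)%N then disc else setT.
have mD i : measurable (D i) by rewrite /D; case: ifP.
have -> : [set w | [forall i : 'I_t, (i < k)%N ==> (normcsq (h w i) < alpha)%R]] =
    \bigcap_(i in [set: 'I_t]) (Z i @^-1` D i).
  apply/seteqP; split => [w /= /forallP hw i _|w /= hw].
    by have /implyP := hw i; rewrite /D; case: ifP => // _; exact.
  apply/forallP => i; apply/implyP => ik.
  by have := hw i Logic.I; rewrite /D /= ik.
split.
  apply: fin_bigcap_measurable => [|i _]; first exact: finite_finset.
  by rewrite -[X in measurable X]setTI; exact: mZ.
rewrite (mutually_independent_pairs mX indep)//.
rewrite (eq_bigr (fun i : 'I_t => if (i < k)%N then p%:E else 1)); last first.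
  move=> i _; rewrite /D; case: ifP => _; first exact: prob_disc.
  by rewrite preimage_setT probability_setT.
rewrite -big_mkcond -(big_ord_widen _ (fun=> p%:E))//.
by rewrite prodEFin prodr_const card_ord.
Qed.

Lemma prob_all_failures :
  P [set w | [forall i : 'I_t, (normcsq (h w i) < alpha)%R]] = (p ^+ t)%:E.
Proof.
have [_ <-] := prob_first_failures (leqnn t); congr (P _).
by apply/seteqP; split => w /= /forallP hw; apply/forallP => i;
  have := hw i; rewrite ltn_ord.
Qed.

Lemma expectation_ntrain : (0 < t)%N ->
  'E_P[fun w => (ntrain (schemeB alpha (h w)))%:R] =
  (expR alpha * (1 - p ^+ t))%:E.
Proof.
move=> t0.
rewrite unlock; under eq_integral do rewrite schemeB_ntrain_sum// -sumEFin.
pose A (j : 'I_t) :=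
  [set w | [forall i : 'I_t, (i < j)%N ==> (normcsq (h w i) < alpha)%R]].
have mA j : measurable (A j) := (prob_first_failures (ltnW (ltn_ord j))).1.
have PA j : P (A j) = (p ^+ j)%:E := (prob_first_failures (ltnW (ltn_ord j))).2.
rewrite (eq_integral (fun w => \sum_(j < t) (\1_(A j) w)%:E)); last first.
  move=> w _; apply: eq_bigr => j _; rewrite indicE.
  by congr ((nat_of_bool _)%:R%:E); apply/idP/idP; rewrite inE.
rewrite ge0_integral_sum//; last first.
  by move=> j; exact/measurable_EFinP/measurable_indic.
rewrite (eq_bigr (fun j : 'I_t => (p ^+ j)%:E)); last first.
  by move=> j _; rewrite integral_indic// setIT -PA.
rewrite sumEFin; congr EFin.
(* Geometric sum: [p^t - 1 = (p - 1) * sum p^j] with [p - 1 = - exp(- alpha)]. *)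
have := subrX1 p t; rewrite -[(p - 1)%R]opprB {2}/p subKr => sumE.
rewrite -opprB sumE.
by rewrite mulNr opprK mulrA -expRD subrr expR0 mul1r.
Qed.

End outage_events.

Theorem theorem1 (R : realType) (d : measure_display) (T : measurableType d)
    (P : probability T R) (t : nat) (alpha : R) (h : T -> 'I_t -> R[i]) :
  (1 <= t)%N -> 0 < alpha -> is_std_CN P h ->
  [/\ outage P alpha h (schemeB alpha) = ((1 - expR (- alpha)) ^+ t)%:E,
      outage P alpha h (@schemeA R t) = ((1 - expR (- alpha)) ^+ t)%:E,
      training_length P h (schemeB alpha)
        = (expR alpha * (1 - (1 - expR (- alpha)) ^+ t))%:E,
      feedback_rate P h (schemeB alpha)
        = (expR alpha * (1 - (1 - expR (- alpha)) ^+ t))%:E &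
      expR alpha * (1 - (1 - expR (- alpha)) ^+ t) < expR alpha].
Proof.
move=> t0 alpha0 hCN; split.
- rewrite -(prob_all_failures alpha0 hCN) /outage; congr (P _).
  by apply/funext => w /=; rewrite schemeB_success.
- rewrite -(prob_all_failures alpha0 hCN) /outage; congr (P _).
  by apply/funext => w /=; rewrite schemeA_success.
- exact: expectation_ntrain.
(* One bit is fed back per trained antenna, so both counters coincide. *)
- exact: expectation_ntrain.
(* Strict because [alpha > 0] makes [1 - exp(- alpha)] positive. *)
- rewrite gtr_pMr ?expR_gt0// gtrBl exprn_gt0// subr_gt0.
  by rewrite expR_lt1 oppr_lt0.
Qed.
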